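(* Let $A$ be a square complex matrix, let $r$ and $n_0$ be positive integers, and suppose $r$ is a simple eigenvalue of $A$ (algebraic multiplicity one) and every other eigenvalue $\lambda$ of $A$ satisfies $\operatorname{Re}(\lambda)<r$. Let vectors $v_n$, for $n\in\{n_0,n_0+r,n_0+2r,\dots\}$, satisfy $v_{n+r}=\left(I+\frac{1}{n}A\right)v_n$ for all such $n\ge n_0$. Then \[\lim_{m\to\infty}\frac{v_{n_0+mr}}{n_0+mr}=P_r^{A}\!\left(\frac{v_{n_0}}{n_0}\right),\] where $P_r^{A}$ is the spectral projection onto the generalized eigenspace of $A$ corresponding to the eigenvalue $r$.
   Context: The spectral projection $P_r^A$: writing $A=SJS^{-1}$ in Jordan form, $P_r^A=S\widetilde{J}S^{-1}$ where $\widetilde{J}$ is obtained from $J$ by replacing the Jordan blocks for eigenvalue $r$ by identity matrices and all other blocks by zero matrices. *)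

(* Defs.v *)
From HB Require Import structures.
From mathcomp Require Import all_boot all_order all_algebra complex.
From mathcomp Require Import all_classical all_reals all_analysis.
Import Order.TTheory GRing.Theory Num.Theory.
Import numFieldNormedType.Exports.

Set Implicit Arguments.
Unset Strict Implicit.
Unset Printing Implicit Defensive.

Local Open Scope ring_scope.
Local Open Scope complex_scope.

(* The library puts the norm topology on every [numClosedFieldType] but this   *)
(* is not inferred for the concrete carrier [R[i]].                            *)
HB.instance Definition _ (R : rcfType) := NormedModule.copy R[i] R[i]^o.

Definition jordan_block (C : fieldType) (a : C) (m : nat) : 'M[C]_m :=
  \matrix_(i, j) (a *+ (i == j) + (i.+1 == j :> nat)%:R).

(* The cast along [e] only identifies the total size of the blocks with [d]. *)
Definition block_diag (C : fieldType) (d k : nat) (p : 'I_k -> nat)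
    (e : (\sum_(i < k) p i)%N = d) (B : forall i, 'M[C]_(p i)) : 'M[C]_d :=
  castmx (e, e) (\mxdiag_(i < k) B i).

(* A Jordan form is not unique, so the projection is given as a relation:      *)
(* [P] is read off some Jordan decomposition [A = S J S^-1], where [J] has k   *)
(* blocks of sizes [p i] and eigenvalues [a i]; several blocks may share an    *)
(* eigenvalue.                                                                 *)
Definition is_spectral_projection (C : fieldType) (d : nat)
    (A : 'M[C]_d) (r : C) (P : 'M[C]_d) : Prop :=
  exists (k : nat) (p : 'I_k -> nat) (a : 'I_k -> C)
         (e : (\sum_(i < k) p i)%N = d) (S : 'M[C]_d),
    [/\ forall i, (0 < p i)%N,
        S \in unitmx,
        A = S *m block_diag e (fun i => jordan_block (a i) (p i)) *m invmx S
      & P = S *m block_diag e (fun i => if a i == r then 1%:M else 0)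
              *m invmx S].

(* Main.v *)
(* In a Jordan basis put z_m = S^-1 v_n / n with n = n0 + m r. A coordinate s
   with eigenvalue a satisfies
     z_{m+1,s} = ((n + a) z_{m,s} + u_m) / (n + r),
   where u_m involves only later coordinates of the same Jordan block. If a = r,
   the block has size one, u_m = 0 and the coordinate is constant. Otherwise
   Re a < r, so |n + a| / (n + r) <= 1 - c / (n + r) for large n, with
   c = (r - Re a) / 2; as u_m -> 0 by induction and the sum of c / (n + r)
   diverges, the coordinate tends to 0. *)
Require Import Defs.
From HB Require Import structures.
From mathcomp Require Import all_boot all_order all_algebra complex.
From mathcomp Require Import all_classical all_reals all_analysis.
From mathcomp Require Import ring lra.
Import Order.TTheory GRing.Theory Num.Theory.
Import numFieldNormedType.Exports.

Set Implicit Arguments.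
Unset Strict Implicit.
Unset Printing Implicit Defensive.

Local Open Scope classical_set_scope.
Local Open Scope ring_scope.
Local Open Scope complex_scope.

(** * Damped recurrences and estimates over the reals *)

(** Once [e n <= eps / 2], the excess of [t] over [eps / 2] shrinks by the factor [1 - b n] at each
    step, and divergence of the sum of [b] drives it to zero. *)
Lemma damped_recurrence_cvg0 (R : realType) (b e t : nat -> R) :
  (\forall n \near \oo, 0 <= b n <= 1) ->
  series b @ \oo --> +oo -> e @ \oo --> 0 -> (forall n, 0 <= t n) ->
  (\forall n \near \oo, t n.+1 <= (1 - b n) * t n + b n * e n) ->
  t @ \oo --> 0.
Proof.
move=> b01 bdvg e0 t0 trec; apply/cvgr0Pnorm_lt => eps eps0.
have h0 : 0 < eps / 2 by rewrite divr_gt0.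
have elt : \forall n \near \oo, e n <= eps / 2.
  move/cvgr0Pnorm_le: e0 => /(_ _ h0).
  by apply: filterS => n; apply: le_trans; exact: ler_norm.
have [N _ HN] : \forall n \near \oo,
    [/\ 0 <= b n <= 1, e n <= eps / 2 & t n.+1 <= (1 - b n) * t n + b n * e n].
  by near=> n; split; near: n.
pose s n := Num.max 0 (t n - eps / 2).
have s0 n : 0 <= s n by rewrite le_max lexx.
have ts n : t n <= s n + eps / 2 by rewrite -lerBlDr le_max lexx orbT.
have srec n : (N <= n)%N -> s n.+1 <= (1 - b n) * s n.
  move=> /HN[/andP[b0 b1] en tn]; rewrite ge_max mulr_ge0 ?subr_ge0 //=.
  have := ler_wpM2l b0 en; have := @ler_wpM2l _ (1 - b n) _ _ _ (ts n).
  by rewrite subr_ge0 => /(_ b1); lra.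
(* [(1 - b) (1 + B + b) <= 1 + B], so [s n * (1 + series b n - series b N)] does
   not increase. *)
have sB k : 0 <= series b (N + k)%N - series b N /\
    s (N + k)%N * (1 + (series b (N + k)%N - series b N)) <= s N.
  elim: k => [|k [B0 IH]]; first by rewrite addn0 subrr addr0 mulr1.
  have [/andP[b0 b1] _ _] := HN (N + k)%N (leq_addr _ _).
  have := srec (N + k)%N (leq_addr _ _).
  have -> : series b (N + k.+1)%N = series b (N + k)%N + b (N + k)%N.
    by rewrite addnS /series /= big_nat_recr.
  rewrite addnS; set B := _ - _ in B0 IH; rewrite addrAC -/B => sk.
  split; first by lra.
  apply: le_trans IH.
  apply: le_trans (ler_wpM2r _ sk) _; first by lra.
  rewrite mulrAC mulrC ler_wpM2l //; nra.
(* With [B] the growth of the series since [N], [B >= s N / (eps / 2)] makes the bound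
   [s N / (1 + B)] smaller than [eps / 2]. *)
have : \forall n \near \oo, series b N + s N / (eps / 2) <= series b n.
  by move/cvgryPge: bdvg; apply.
have : \forall n \near \oo, (N <= n)%N by exact: nbhs_infty_ge.
apply: filterS2 => n /subnKC <-; have [B0 IH] := sB (n - N)%N.
rewrite -lerBrDl ler_pdivrMr // => Bn; rewrite ger0_norm //.
apply: le_lt_trans (ts _) _; rewrite -ltrBrDr.
have -> : eps - eps / 2 = eps / 2 by lra.
by rewrite ltNge; apply/negP => sn; nra.
Unshelve. all: by end_near. Qed.

(** Comparison with the harmonic series through [p + m q <= (p + q) (m + 1)]. *)
Lemma series_inv_arith_dvg (R : realType) (c p q : R) :
  0 < c -> 0 < p -> 0 < q ->
  series (fun m : nat => c / (p + m%:R * q)) @ \oo --> +oo.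
Proof.
move=> c0 p0 q0.
have hdvg : series (@harmonic R) @ \oo --> +oo.
  apply: nondecreasing_dvgn_lt; last exact: dvg_harmonic.
  by apply/nondecreasing_series => n _ _; exact: harmonic_ge0.
have k0 : 0 < c / (p + q) by rewrite divr_gt0 ?addr_gt0.
apply/cvgryPge => M; move/cvgryPge: hdvg => /(_ (M / (c / (p + q)))).
apply: filterS => n; rewrite ler_pdivrMr // => /le_trans; apply.
rewrite /series /= mulr_suml; apply: ler_sum => i _.
have i0 : 0 <= i%:R :> R by [].
rewrite /harmonic /= mulrC -mulrA ler_pM2l // -invfM lef_pV2 ?posrE; nra.
Qed.

Lemma near_normcD_le (R : realType) (a : R[i]) (c : R) : 0 < c ->
  \forall x \near +oo, Normc.normc (x%:C + a) <= x + complex.Re a + c.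
Proof.
case: a => u w c0 /=; near=> x.
(* That is, [w ^+ 2 <= 2 c (x + u)], which gives [(x + u) ^+ 2 + w ^+ 2 <= (x + u + c) ^+ 2]. *)
have xu : w ^+ 2 / (2 * c) - u <= x
  by near: x; apply: nbhs_pinfty_ge; exact: num_real.
rewrite add0r -[leRHS]ger0_norm; last first.
  have : 0 <= w ^+ 2 / (2 * c) by rewrite divr_ge0 ?sqr_ge0 ?mulr_ge0 ?ltW.
  lra.
rewrite -sqrtr_sqr ler_wsqrtr //.
move: xu; rewrite lerBlDr ler_pdivrMr ?mulr_gt0 //; nra.
Unshelve. all: by end_near. Qed.

(** * Matrix limits and complex scalar recurrences *)

Lemma cvg_mx (T : Type) (F : set_system T) (FF : Filter F) (U : puniformType)
    (m n : nat) (f : T -> 'M[U]_(m, n)) (l : 'M[U]_(m, n)) :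
  (forall i j, (fun x => f x i j) @ F --> l i j) -> f @ F --> l.
Proof.
move=> fl; apply/cvg_mx_entourageP => A entA.
apply: (@filter_forall _ _ (fun i x => forall j, (l i j, f x i j) \in A) F) => i.
apply: (@filter_forall _ _ (fun j x => (l i j, f x i j) \in A) F) => j.
move/cvg_entourageP: (fl i j) => /(_ A entA).
rewrite near_simpl; apply: filterS => x Ax; exact/mem_set.
Qed.

(** The norm on [R[i]] takes its values in [R[i]]; this passes to the real modulus, where the damped
    recurrence applies. *)
Lemma normc_cvg0 (R : realType) (u : nat -> R[i]) :
  (u @ \oo --> 0) <-> ((fun n => Normc.normc (u n)) @ \oo --> 0).
Proof.
split=> [u0|u0].
  apply/cvgr0Pnorm_lt => e e0.
  move/cvgr0Pnorm_lt: u0 => /(_ e%:C).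
  rewrite ltcR => /(_ e0); apply: filterS => n.
  by rewrite normc_def ltcR; case: (u n) => x y /=; rewrite ger0_norm ?sqrtr_ge0.
(* A positive element of [R[i]] has zero imaginary part, so the tolerance is the real number [e]. *)
apply/cvgr0Pnorm_lt => -[e f]; rewrite ltcE /= => /andP[/eqP -> e0].
move/cvgr0Pnorm_lt: u0 => /(_ e e0); apply: filterS => n.
by rewrite normc_def ltcR; case: (u n) => x y /=; rewrite ger0_norm ?sqrtr_ge0.
Qed.

Lemma arith_progression_cvgy (R : realType) (n0 r : nat) : (0 < r)%N ->
  (fun m => (n0 + m * r)%:R : R) @ \oo --> +oo.
Proof.
move=> r0; apply/cvgryPge => M.
move/cvgryPge: (@cvgr_idn R) => /(_ M).
apply: filterS => m /le_trans; apply.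
by rewrite ler_nat (leq_trans (leq_pmulr m r0)) ?leq_addl.
Qed.

Lemma euler_recurrence_cvg0 (R : realType) (r n0 : nat) (a : R[i])
    (z u : nat -> R[i]) :
  (0 < r)%N -> complex.Re a < r%:R -> u @ \oo --> 0 ->
  (forall m, let n := (n0 + m * r)%N in
     z m.+1 = ((n%:R + a) * z m + u m) / (n + r)%:R) ->
  z @ \oo --> 0.
Proof.
move=> r0 ar /normc_cvg0 u0 zrec; apply/normc_cvg0.
have R0 : 0 < r%:R :> R by rewrite ltr0n.
(* Half the spectral gap: the eventual bound [n + Re a + c] on the modulus of [n + a] is then
   exactly [n + r - c]. *)
pose c : R := (r%:R - complex.Re a) / 2.
have c0 : 0 < c by rewrite /c; lra.
pose n m : R := (n0 + m * r)%:R.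
have n_ge0 m : 0 <= n m by [].
have nrE m : n0%:R + r%:R + m%:R * r%:R = n m + r%:R :> R.
  by rewrite /n natrD natrM; lra.
(* The damping is [c / (n + r)]; dividing the modulus of [u m] by [c] makes the product [b e] the
   forcing term. *)
apply: (@damped_recurrence_cvg0 _ (fun m => c / (n0%:R + r%:R + m%:R * r%:R))
  (fun m => Normc.normc (u m) / c)).
- have := @arith_progression_cvgy R n0 _ r0.
  move/cvgryPge => /(_ c); apply: filterS => m; rewrite -/(n m) nrE => cn.
  have nr0 : 0 < n m + r%:R by rewrite ltr_wpDl.
  by rewrite divr_ge0 ?(ltW c0) ?(ltW nr0) //= ler_pdivrMr // mul1r; lra.
- by apply: series_inv_arith_dvg => //; rewrite ltr_wpDl.
- rewrite -[0](mul0r c^-1); apply: cvgM => //; exact: cvg_cst.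
- by move=> m; case: (z m) => x y; rewrite sqrtr_ge0.
have : \forall m \near \oo,
    Normc.normc ((n m)%:C + a) <= n m + complex.Re a + c.
  exact: (@arith_progression_cvgy R n0 _ r0 _ (near_normcD_le a c0)).
apply: filterS => m na.
rewrite nrE zrec Normc.normcM Normc.normcV.
have -> : Normc.normc ((n0 + m * r + r)%:R : R[i]) = n m + r%:R.
  rewrite -(rmorph_nat (real_complex R)) /= expr0n addr0 sqrtr_sqr ger0_norm //.
  by rewrite natrD.
rewrite ler_pdivrMr ?ltr_wpDl //.
apply: le_trans (le_normcD _ _) _; rewrite Normc.normcM.
have z0 : 0 <= Normc.normc (z m) by case: (z m) => x y; rewrite sqrtr_ge0.
rewrite -(rmorph_nat (real_complex R)) /=.
apply: le_trans (lerD (ler_wpM2r z0 na) (lexx _)) _.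
have nr0 : n m + r%:R != 0 by rewrite gt_eqF ?ltr_wpDl.
rewrite le_eqVlt; apply/orP; left; apply/eqP.
have -> : n m + complex.Re a + c = n m + r%:R - c by rewrite /c; lra.
have key (x y k t w : R) : x + y != 0 -> k != 0 ->
    (x + y - k) * t + w
    = ((1 - k / (x + y)) * t + k / (x + y) * (w / k)) * (x + y).
  by move=> xy k0; field; rewrite xy k0.
by apply: key => //; rewrite gt_eqF.
Qed.

(** * Entries of a Jordan matrix *)

Lemma mxdiag_jordanE (C : fieldType) (k : nat) (p : 'I_k -> nat)
    (a : 'I_k -> C) s t :
  (\mxdiag_i jordan_block (a i) (p i)) s t =
  if tagnat.sig1 s == tagnat.sig1 t
  then a (tagnat.sig1 s) *+ (tagnat.sig2 s == tagnat.sig2 t :> nat)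
         + ((tagnat.sig2 s).+1 == tagnat.sig2 t)%:R
  else 0.
Proof.
rewrite mxE; move: (tagnat.sig2 s) (tagnat.sig2 t).
case: eqVneq => [<- x y|_ x y]; last by rewrite mxE.
by rewrite conform_mx_id mxE.
Qed.

Lemma eq_tagnat_sig (k : nat) (p : 'I_k -> nat) (s t : 'I_(\sum_i p i)) :
  (s == t) = (tagnat.sig1 s == tagnat.sig1 t)
             && (tagnat.sig2 s == tagnat.sig2 t :> nat).
Proof. by rewrite -tagnat.eq_Rank !tagnat.sig2K. Qed.

Lemma mxdiag_jordan_diag (C : fieldType) (k : nat) (p : 'I_k -> nat)
    (a : 'I_k -> C) s :
  (\mxdiag_i jordan_block (a i) (p i)) s s = a (tagnat.sig1 s).
Proof. by rewrite mxdiag_jordanE !eqxx gtn_eqF ?addr0. Qed.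

Lemma mxdiag_jordan_upper (C : fieldType) (k : nat) (p : 'I_k -> nat)
    (a : 'I_k -> C) (s t : 'I_(\sum_i p i)) :
  (t < s)%N -> (\mxdiag_i jordan_block (a i) (p i)) s t = 0.
Proof.
move=> ts; rewrite mxdiag_jordanE; case: eqP => // e.
have : (tagnat.sig2 t < tagnat.sig2 s)%N.
  (* Indices of one block share the same offset, so their order is that of their places in the
     block. *)
  have eS : (\sum_(i < k | (i < tagnat.sig1 s)%N) p i =
             \sum_(i < k | (i < tagnat.sig1 t)%N) p i)%N by rewrite e.
  move: ts; rewrite [in X in (X < _)%N -> _]tagnat.rect (tagnat.rect s).
  by rewrite eS ltn_add2l.
move=> lt; rewrite gtn_eqF // gtn_eqF ?addr0 //.
by rewrite (ltn_trans lt).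
Qed.

(** Nonzero entries stay inside one block, so only coordinates with a common eigenvalue are
    coupled. *)
Lemma mxdiag_jordan_same_eigen (C : fieldType) (k : nat) (p : 'I_k -> nat)
    (a : 'I_k -> C) s t : let J := \mxdiag_i jordan_block (a i) (p i) in
  J s t != 0 -> J s s = J t t.
Proof.
rewrite /= !mxdiag_jordan_diag mxdiag_jordanE.
by case: ifP => [/eqP e _|_]; [rewrite e | rewrite eqxx].
Qed.

(** Reading the projection off the diagonal of [J] lets the limit argument avoid block indices. *)
Lemma mxdiag_eigen_projE (C : fieldType) (k : nat) (p : 'I_k -> nat)
    (a : 'I_k -> C) (r : C) s t :
  let J := \mxdiag_i jordan_block (a i) (p i) in
  (\mxdiag_i (if a i == r then 1%:M else 0 : 'M[C]_(p i))) s t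
  = ((J s s == r) && (s == t))%:R.
Proof.
rewrite /= mxdiag_jordan_diag eq_tagnat_sig mxE.
move: (tagnat.sig2 s) (tagnat.sig2 t).
case: eqVneq => [<- x y|_ x y]; last by rewrite mxE andbF.
by rewrite conform_mx_id; case: ifP => _; rewrite mxE.
Qed.

(** * Characteristic polynomial and simplicity *)

Lemma char_poly_conj (F : fieldType) (d : nat) (S J : 'M[F]_d) :
  S \in unitmx -> char_poly (S *m J *m invmx S) = char_poly J.
Proof.
move=> uS; pose SP := map_mx polyC S.
have uSP : SP \in unitmx by rewrite map_unitmx.
rewrite /char_poly; have -> : char_poly_mx (S *m J *m invmx S)
    = SP *m char_poly_mx J *m invmx SP.
  rewrite /char_poly_mx mulmxBr mulmxBl !map_mxM /= map_invmx.
  by rewrite scalar_mxC mulmxK.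
by rewrite !det_mulmx mulrAC -det_mulmx mulmxV // det1 mul1r.
Qed.

Lemma char_poly_upper (F : comNzRingType) (d : nat) (J : 'M[F]_d) :
  (forall s t : 'I_d, (t < s)%N -> J s t = 0) ->
  char_poly J = \prod_(i < d) ('X - (J i i)%:P).
Proof.
(* [char_poly_trig] concerns lower triangular matrices. *)
move=> up; have -> : char_poly J = char_poly J^T.
  rewrite /char_poly -det_tr; congr (\det _).
  by rewrite /char_poly_mx linearB /= tr_scalar_mx map_trmx.
rewrite char_poly_trig; last by apply/is_trig_mxP => s t st; rewrite mxE up.
by apply: eq_bigr => i _; rewrite mxE.
Qed.

(** The multiplicity counts the indices where [f] equals [r]. On a Jordan diagonal this leaves [r] a
    single block, of size one. *)
Lemma mup1_diag_inj (F : fieldType) (d : nat) (f : 'I_d -> F) (r : F) :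
  mup r (\prod_(i < d) ('X - (f i)%:P)) = 1%N ->
  forall s t, f s = r -> f t = r -> s = t.
Proof.
rewrite -(big_map f xpredT (fun x => 'X - x%:P)) mu_prod_XsubC.
rewrite count_map => c1 s t fs ft.
have /card_le1_eqP inj : (#|[pred i | f i == r]| <= 1)%N.
  by rewrite -c1 -sum1_card -sum1_count; exact: leqnn.
by apply: inj; rewrite inE; exact/eqP.
Qed.

(** * Limits of the coordinates and return to the original basis *)

Lemma cvg_sum (K : numFieldType) (V : normedModType K) (T I : Type)
    (F : set_system T) (FF : Filter F) (r : seq I) (P : pred I)
    (f : I -> T -> V) (l : I -> V) :
  (forall i, P i -> f i @ F --> l i) ->
  (fun x => \sum_(i <- r | P i) f i x) @ F --> \sum_(i <- r | P i) l i.
Proof.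
apply: cvg_big; exact: add_continuous.
Qed.

Lemma cvg_mulmx (K : numFieldType) (T : Type) (F : set_system T) (FF : Filter F)
    (m n p : nat) (S : 'M[K]_(m, n)) (f : T -> 'M[K]_(n, p)) (l : 'M[K]_(n, p)) :
  (forall i j, (fun x => f x i j) @ F --> l i j) ->
  (fun x => S *m f x) @ F --> S *m l.
Proof.
move=> fl; apply: cvg_mx => i j; rewrite mxE; under eq_fun do rewrite mxE.
by apply: cvg_sum => k _; apply: cvgM; [exact: cvg_cst|exact: fl].
Qed.

Lemma triangular_euler_cvg (R : realType) (d r n0 : nat) (J : 'M[R[i]]_d)
    (z : nat -> 'cV[R[i]]_d) :
  (0 < r)%N ->
  (forall s t : 'I_d, (t < s)%N -> J s t = 0) ->
  (forall s t, J s t != 0 -> J s s = J t t) ->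
  (forall s t, J s s = r%:R -> J t t = r%:R -> s = t) ->
  (forall s, J s s != r%:R -> complex.Re (J s s) < r%:R) ->
  (forall m, let n := (n0 + m * r)%N in
     z m.+1 = (n + r)%:R^-1 *: (n%:R *: z m + J *m z m)) ->
  forall s, (fun m => z m s 0) @ \oo -->
    (if J s s == r%:R then z 0%N s 0 else 0 : R[i]).
Proof.
move=> r0 Jup Jsame Jinj Jre zrec.
have zrecE m s : let n := (n0 + m * r)%N in z m.+1 s 0 =
    ((n%:R + J s s) * z m s 0 + \sum_(t | t != s) J s t * z m t 0) / (n + r)%:R.
  by rewrite /= zrec !mxE (bigD1 s) //= mulrC addrA -mulrDl.
(* Induction from the last coordinate upwards. *)
move=> s; have [k] := ubnP (d - s); elim: k s => // k IH s sk.
case: (eqVneq (J s s) r%:R) => [Jsr|Jsr].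
  (* A nonzero [J s t] would put [r] on the diagonal at [t] too, forcing [t = s]; only the factor
     [(n + r) / (n + r)] remains. *)
  have -> : (fun m => z m s 0) = fun=> z 0%N s 0; last exact: cvg_cst.
  apply: funext; elim=> // m <-; rewrite zrecE big1 ?addr0 => [|t ts].
    rewrite Jsr -natrD mulrAC divff ?mul1r //.
    by rewrite pnatr_eq0 -lt0n addn_gt0 r0 orbT.
  have [->|/Jsame Jst] := eqVneq (J s t) 0; first by rewrite mul0r.
  by rewrite (Jinj t s) ?eqxx -?Jst // in ts.
apply: (@euler_recurrence_cvg0 _ r n0 (J s s) _
  (fun m => \sum_(t | t != s) J s t * z m t 0)) => //; first exact: Jre.
suff : (fun m => \sum_(t | t != s) J s t * z m t 0) @ \oo -->
    \sum_(t | t != s) (0 : R[i]) by rewrite [X in _ --> X]big1.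
apply: cvg_sum => t ts.
have [Jst|Jst] := eqVneq (J s t) 0.
  by under eq_fun do rewrite Jst mul0r; exact: cvg_cst.
suff : (fun m => J s t * z m t 0) @ \oo --> J s t * 0 by rewrite mulr0.
apply: cvgM; first exact: cvg_cst.
have st : (s < t)%N.
  by rewrite ltn_neqAle eq_sym ts leqNgt; apply: contraNN Jst => /Jup ->.
(* The eigenvalue at [t] is that at [s], hence not [r], so the induction hypothesis gives limit
   zero. *)
have := IH t; rewrite -(Jsame s t Jst) (negbTE Jsr); apply.
by rewrite -ltnS; apply: leq_trans sk; rewrite ltnS ltn_sub2l.
Qed.

Lemma conj_euler_step (F : fieldType) (d : nat) (S J : 'M[F]_d)
    (n : F) (v : 'cV[F]_d) : S \in unitmx -> n != 0 ->
  let z := n^-1 *: (invmx S *m v) in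
  invmx S *m ((1%:M + n^-1 *: (S *m J *m invmx S)) *m v) = n *: z + J *m z.
Proof.
move=> uS n0 /=; rewrite scalerA divff // scale1r mulmxDl mul1mx mulmxDr.
congr (_ + _); rewrite -scalemxAl -!scalemxAr; congr (_ *: _).
by rewrite -!mulmxA mulKmx.
Qed.

Lemma coord_proj_mulE (F : nzSemiRingType) (d : nat) (E : 'M[F]_d)
    (b : pred 'I_d) (w : 'cV[F]_d) :
  (forall s t, E s t = (b s && (s == t))%:R) ->
  forall s, (E *m w) s 0 = if b s then w s 0 else 0.
Proof.
move=> EE s; rewrite mxE (bigD1 s) //= big1 => [|t ts]; last first.
  by rewrite EE eq_sym (negbTE ts) andbF mul0r.
by rewrite EE eqxx andbT addr0; case: (b s); rewrite ?mul1r ?mul0r.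
Qed.

Theorem theorem1 (R : realType) (d : nat) (A : 'M[R[i]]_d) (r n0 : nat)
    (r_gt0 : (0 < r)%N) (n0_gt0 : (0 < n0)%N)
    (r_simple : mup (r%:R : R[i]) (char_poly A) = 1%N)
    (other_eigen : forall lambda : R[i],
      eigenvalue A lambda -> lambda != r%:R -> complex.Re lambda < r%:R)
    (v : nat -> 'cV[R[i]]_d)
    (v_rec : forall m : nat, let n := (n0 + m * r)%N in
      v (n + r)%N = (1%:M + (n%:R)^-1 *: A) *m v n)
    (P : 'M[R[i]]_d) (P_proj : is_spectral_projection A r%:R P) :
  (fun m : nat => ((n0 + m * r)%N%:R)^-1 *: v (n0 + m * r)%N) @ \oo
    --> P *m ((n0%:R)^-1 *: v n0).
Proof.
case: P_proj => k [p [a [e [S [_ uS defA defP]]]]].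
(* Replacing [d] by the total block size makes the casts trivial. *)
case: d / e => /= in A r_simple other_eigen v v_rec P S uS defA defP *.
rewrite /block_diag castmx_id in defA; rewrite /block_diag castmx_id in defP.
set J := mxdiag _ in defA; set E := mxdiag _ in defP.
have Jup (s t : 'I_(\sum_(i < k) p i)) : (t < s)%N -> J s t = 0.
  exact: mxdiag_jordan_upper.
have charA : char_poly A = \prod_i ('X - (J i i)%:P).
  by rewrite defA char_poly_conj // char_poly_upper.
have Jinj := mup1_diag_inj (etrans (congr1 _ (esym charA)) r_simple).
have Jre s : J s s != r%:R -> complex.Re (J s s) < r%:R.
  apply: other_eigen; rewrite eigenvalue_root_char charA.
  by rewrite /root (bigD1 s) //= hornerM hornerXsubC subrr mul0r.
pose z m := (n0 + m * r)%N%:R^-1 *: (invmx S *m v (n0 + m * r)%N).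
have n_neq0 m : (n0 + m * r)%:R != 0 :> R[i].
  by rewrite pnatr_eq0 -lt0n addn_gt0 n0_gt0.
have zrec m : let n := (n0 + m * r)%N in
    z m.+1 = (n + r)%:R^-1 *: (n%:R *: z m + J *m z m).
  rewrite /= /z mulSn addnCA addnC; set n := (n0 + m * r)%N.
  rewrite v_rec -/n; congr (_ *: _).
  by rewrite defA conj_euler_step ?n_neq0.
have zcvg := triangular_euler_cvg r_gt0 Jup
  (@mxdiag_jordan_same_eigen _ _ p a) Jinj Jre zrec.
have z0E := coord_proj_mulE (z 0%N) (mxdiag_eigen_projE a r%:R).
have vE m : (n0 + m * r)%N%:R^-1 *: v (n0 + m * r)%N = S *m z m.
  by rewrite /z -scalemxAr mulKVmx.
(* The sequence and its limit are now both images under [S], so coordinatewise convergence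
   suffices. *)
have -> : P *m (n0%:R^-1 *: v n0) = S *m (E *m z 0%N).
  by rewrite defP /z mul0n addn0 -!scalemxAr !mulmxA.
rewrite (funext vE); apply: cvg_mulmx => s j; rewrite (ord1 j).
rewrite z0E; exact: zcvg.
Qed.
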